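(* Consider a finite Markov decision process with state space $\mathcal{S}$, action space $\mathcal{A}$ ($|\mathcal{S}\times\mathcal{A}|<\infty$), random rewards $r(s,a)$ with $\operatorname{Var}[r(s,a)]<\infty$ for all $s,a$, and discount factor $\gamma\in[0,1)$; let $Q^*$ be its optimal action-value function. Fix $K\in\{1,\dots,|\mathcal{A}|\}$. Two Q-functions $Q^A,Q^B$ are stored in lookup tables and updated simultaneously (action candidate based clipped Double Q-learning with simultaneous updating): at each step $t$, given experience $\langle s_t,a_t,r_t,s_{t+1}\rangle$, let $\mathcal{M}_K$ be the set of actions whose values are among the top $K$ values of $Q^B_t(s_{t+1},\cdot)$, $a_K^*=\arg\max_{a\in\mathcal{M}_K}Q^A_t(s_{t+1},a)$, $a^*=\arg\max_aQ^A_t(s_{t+1},a)$, set $$y_t=r_t+\gamma\min\{Q^B_t(s_{t+1},a_K^* ),Q^A_t(s_{t+1},a^* )\},$$ and update $Q^A_{t+1}(s_t,a_t)=Q^A_t(s_t,a_t)+\alpha_t(s_t,a_t)(y_t-Q^A_t(s_t,a_t))$ and $Q^B_{t+1}(s_t,a_t)=Q^B_t(s_t,a_t)+\alpha_t(s_t,a_t)(y_t-Q^B_t(s_t,a_t))$. Assume: (1) each state-action pair is sampled an infinite number of times; (2) both $Q^A$ and $Q^B$ receive an infinite number of updates; (3) the learning rates satisfy $\alpha_t(s,a)\in[0,1]$, $\sum_t\alpha_t(s,a)=\infty$, $\sum_t\alpha_t(s,a)^2<\infty$ with probability 1, and $\alpha_t(s,a)=0$ for all $(s,a)\neq(s_t,a_t)$.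 Then this algorithm converges to the optimal value function $Q^*$ with probability 1.
   Context: The optimal action-value function $Q^*$ satisfies the Bellman optimality equation $Q^*(s,a)=R(s,a)+\gamma\sum_{s'}\mathcal{P}_{sa}^{s'}\max_{a'}Q^*(s',a')$, where $R$ is the expected reward and $\mathcal{P}$ the transition probability.
   Formalization: The learning rates are additionally assumed to depend only on the past up to the current state and action, not on the reward or next state about to be observed; without this the claim fails, e.g. for a rate that is nonzero only when the reward is high. *)

(* Defs.v *)
From HB Require Import structures.
From mathcomp Require Import all_boot all_order all_algebra.
From mathcomp Require Import all_classical all_reals all_analysis.
Set Implicit Arguments. Unset Strict Implicit. Unset Printing Implicit Defensive.
Import Order.TTheory GRing.Theory Num.Theory.
Local Open Scope ring_scope.
Local Open Scope classical_set_scope.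

Section ACDQ.
Variables (R : realType) (S A : finType).

(* max_a f a over the finite (nonempty) action set; 0 if A is empty. *)
Definition maxA (f : A -> R) : R :=
  match [pick b : A] with
  | Some b0 => \big[Num.max/f b0]_(b : A) f b
  | None => 0
  end.

Definition bellman_opt (gamma : R) (Ptr : S -> A -> S -> R) (Rw : S -> A -> R)
  (Q : S -> A -> R) : Prop :=
  forall x y, Q x y = Rw x y + gamma * \sum_(x' : S) Ptr x y x' * maxA (Q x').

(* [sel qb qa] is a valid choice of a_K^*: there is a set M_K of exactly K
   actions holding the top K values of qb, sel qb qa lies in M_K and
   maximizes qa over M_K (ties broken arbitrarily). *)
Definition topK_argmax_rule (K : nat) (sel : (A -> R) -> (A -> R) -> A) : Prop :=
  forall qb qa : A -> R, exists M : {set A},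
    [/\ #|M| = K,
        (forall b c, b \in M -> c \notin M -> qb c <= qb b),
        sel qb qa \in M &
        (forall c, c \in M -> qa c <= qa (sel qb qa))].

Fixpoint acdq_iter (Omega : Type) (gamma : R) (sel : (A -> R) -> (A -> R) -> A)
  (QA0 QB0 : S -> A -> R) (s : nat -> Omega -> S) (r : nat -> Omega -> R)
  (alpha : nat -> S -> A -> Omega -> R) (t : nat) (w : Omega)
  : (S -> A -> R) * (S -> A -> R) :=
  match t with
  | 0 => (QA0, QB0)
  | t'.+1 =>
    let: (qa, qb) := acdq_iter gamma sel QA0 QB0 s r alpha t' w in
    let s' := s t'.+1 w in
    let y := r t' w + gamma * Num.min (qb s' (sel (qb s') (qa s'))) (maxA (qa s')) in
    (fun x b => qa x b + alpha t' x b w * (y - qa x b),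
     fun x b => qb x b + alpha t' x b w * (y - qb x b))
  end.

End ACDQ.

(* Main.v *)
(** The difference of the two tables obeys a homogeneous averaging recursion, so
    it vanishes, and the clipped target is within three times that difference of
    [max QA].  Since the selection rule [sel] need not be measurable, no
    probabilistic argument is applied to the iterates themselves.  They are
    compared, path by path, with an oracle scheme that averages the targets
    [r + gamma * max Qstar(s')].  The error of the oracle is weighted martingale
    noise with bounded conditional variance, which vanishes almost surely by
    Kolmogorov's maximal inequality; the distance from the iterates to the oracle
    satisfies a [gamma]-contractive averaging recursion with a vanishing
    perturbation, so it tends to zero on every path. *)

Require Import Defs.
From HB Require Import structures.
From mathcomp Require Import all_boot all_order all_algebra.
From mathcomp Require Import all_classical all_reals all_analysis.
From mathcomp Require Import measurable_realfun lra ring.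
Import Order.TTheory GRing.Theory Num.Theory numFieldNormedType.Exports.
Local Open Scope ring_scope.
Local Open Scope classical_set_scope.

Set Implicit Arguments.
Unset Strict Implicit.
Unset Printing Implicit Defensive.

(** * Deterministic averaging recursions with divergent step sizes *)

Section averaging_recursions.
Context {R : realType}.
Implicit Types (al u : nat -> R) (c : R).

Definition sum_diverges al :=
  forall B : R, exists T, B <= \sum_(0 <= t < T) al t.

Lemma sum_diverges_from al N : (forall t, 0 <= al t) -> sum_diverges al ->
  forall B, exists2 T, (N <= T)%N & B <= \sum_(N <= t < T) al t.
Proof.
move=> al0 dal B.
have [T BT] := dal (B + \sum_(0 <= t < N) al t).
exists (maxn N T); first exact: leq_maxl.
rewrite -(lerD2r (\sum_(0 <= t < N) al t)) (le_trans BT)//.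
rewrite addrC -big_cat_nat ?leq_maxl//=.
rewrite [leRHS](@big_cat_nat _ _ _ T) ?leq_maxr//= lerDl.
exact: sumr_ge0.
Qed.

(** The excess of [u] over [c], cut off at zero, shrinks at each step by the factor
    [1 - al t <= expR (- al t)]. It therefore decays like the exponential of minus a divergent
    sum. *)
Lemma averaging_near_le al u c : (forall t, 0 <= al t <= 1) -> sum_diverges al ->
  (\forall t \near \oo, u t.+1 <= (1 - al t) * u t + al t * c) ->
  forall e : R, 0 < e -> \forall t \near \oo, u t <= c + e.
Proof.
move=> al01 dal [N _ uN] e e0.
have al0 t : 0 <= al t by case/andP: (al01 t).
pose m t : R := Num.max (u t - c) 0.
have m0 t : 0 <= m t by rewrite le_max lexx orbT.
have mS t : (N <= t)%N -> m t.+1 <= (1 - al t) * m t.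
  move=> Nt; have /andP[a0 a1] := al01 t.
  rewrite ge_max mulr_ge0 ?subr_ge0// andbT.
  have : u t - c <= m t by rewrite le_max lexx.
  have := uN t Nt => /= h1 h2.
  have : (1 - al t) * (u t - c) <= (1 - al t) * m t by rewrite ler_wpM2l ?subr_ge0.
  lra.
have mN t : (N <= t)%N -> m t <= m N * expR (- \sum_(N <= i < t) al i).
  elim: t => [|t IH]; first by rewrite leqn0 => /eqP ->; rewrite big_geq// oppr0 expR0 mulr1.
  rewrite leq_eqVlt => /predU1P[<-|]; first by rewrite big_geq// oppr0 expR0 mulr1.
  rewrite ltnS => Nt; apply: (le_trans (mS _ Nt)).
  rewrite big_nat_recr//= opprD expRD mulrA mulrC.
  have /andP[a0 a1] := al01 t.
  rewrite ler_pM ?subr_ge0 ?IH//.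
  exact: expR_ge1Dx.
(* Since [x <= expR x], the bound [m N * expR (- x) <= e] holds as soon as [m N / e <= x]. *)
have [T NT BT] := sum_diverges_from N al0 dal (m N / e).
exists T => // t /= Tt.
have mt : m t <= e.
  apply: (le_trans (mN _ (leq_trans NT Tt))).
  rewrite expRN ler_pdivrMr ?expR_gt0//.
  have : m N / e <= \sum_(N <= i < t) al i.
    rewrite (le_trans BT)// [leRHS](@big_cat_nat _ _ _ T)//= lerDl.
    exact: sumr_ge0.
  rewrite ler_pdivrMr// mulrC => /le_trans; apply.
  rewrite ler_pM2l//; apply: le_trans (expR_ge1Dx _).
  by rewrite lerDr.
have : u t - c <= m t by rewrite le_max lexx.
lra.
Qed.

(** The triangle inequality reduces this to [averaging_near_le] for [|u|], with [e / 2] as the level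
    and [e / 2] as the slack. *)
Lemma averaging_cvg0 al u (eta : nat -> R) :
  (forall t, 0 <= al t <= 1) -> sum_diverges al ->
  (forall t, u t.+1 = (1 - al t) * u t + al t * eta t) ->
  eta @ \oo --> 0 -> u @ \oo --> 0.
Proof.
move=> al01 dal uS eta0; apply/cvgr0Pnorm_le => e e0.
have e2 : 0 < e / 2 by lra.
have := averaging_near_le (u := fun t => `|u t|) (c := e / 2) al01 dal.
suff H : \forall t \near \oo, `|u t.+1| <= (1 - al t) * `|u t| + al t * (e / 2).
  move=> /(_ H _ e2); apply: filterS => t /=; lra.
move/cvgr0Pnorm_le : eta0 => /(_ _ e2); apply: filterS => t et.
have /andP[a0 a1] := al01 t.
rewrite uS (le_trans (ler_normD _ _))// !normrM.
rewrite ger0_norm ?subr_ge0// lerD2l ger0_norm//.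
by rewrite ler_wpM2l.
Qed.

(* Subtracting the tail of the noise series leaves a recursion driven by that
   tail, which vanishes. *)
Lemma robbins_monro_cvg0 al u (xi : nat -> R) :
  (forall t, 0 <= al t <= 1) -> sum_diverges al ->
  (forall t, u t.+1 = (1 - al t) * u t + al t * xi t) ->
  cvgn (series (fun t => al t * xi t)) -> u @ \oo --> 0.
Proof.
move=> al01 dal uS; set M := series _ => cM.
pose L := limn M.
have ML : (fun t => M t - L) @ \oo --> 0.
  by rewrite -(subrr L); apply: (cvgB cM); exact: cvg_cst.
have : (fun t => u t - (M t - L)) @ \oo --> 0.
  apply: (@averaging_cvg0 al _ (fun t => - (M t - L))) => //; last first.
    by rewrite -oppr0; exact: cvgN.
  by move=> t; rewrite uS /M seriesSr; ring.
move=> h; rewrite (_ : u = fun t => (u t - (M t - L)) + (M t - L)).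
  by rewrite -[X in _ --> X]addr0; exact: cvgD.
by apply/funext => t; rewrite subrK.
Qed.

(* The infimum [L] of the eventual bounds satisfies [L <= gamma * L]. *)
Lemma contraction_cvg0 (I : finType) (al D : nat -> I -> R) (eta : nat -> R)
    (gamma : R) :
  0 <= gamma < 1 ->
  (forall i t, 0 <= al t i <= 1) -> (forall i, sum_diverges (al^~ i)) ->
  (forall t (b : R), (forall i, `|D t i| <= b) ->
     forall i, `|D t.+1 i| <=
       (1 - al t i) * `|D t i| + al t i * (gamma * (b + eta t))) ->
  eta @ \oo --> 0 -> forall i, D ^~ i @ \oo --> 0.
Proof.
move=> /andP[g0 g1] al01 dal DS eta0 i0.
have near_eta (e : R) : 0 < e -> \forall t \near \oo, eta t <= e.
  move=> e0; move/cvgr0Pnorm_le : eta0 => /(_ _ e0).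
  by apply: filterS => t; apply: le_trans; exact: ler_norm.
pose P (c : R) := 0 <= c /\ \forall t \near \oo, forall i, `|D t i| <= c.
have [c0 Pc0] : exists c, P c.
  have [N _ eN] := near_eta 1 ltr01.
  pose b0 := \sum_i `|D N i|.
  (* The summand [gamma / (1 - gamma)] is the fixed point of [x |-> gamma * (x + 1)]. Hence
     [gamma * (B + 1) <= B], and the bound [B] propagates from time [N] on, where [eta t <= 1]. *)
  pose B := b0 + gamma / (1 - gamma).
  have q0 : 0 <= gamma / (1 - gamma) by rewrite divr_ge0// subr_ge0 ltW.
  have b00 : 0 <= b0 by exact: sumr_ge0.
  have gB : gamma * (B + 1) <= B.
    have -> : B = b0 + gamma / (1 - gamma) by [].
    have : gamma / (1 - gamma) * (1 - gamma) = gamma.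
      by rewrite divfK// subr_eq0 gt_eqF.
    set q := gamma / _ in q0 *; move=> qE.
    have : gamma * b0 <= b0 by rewrite ler_piMl// ltW.
    nra.
  exists B; split; first by rewrite addr_ge0.
  exists N => // t /= Nt.
  elim: t Nt => [|t IH].
    rewrite leqn0 => /eqP N0 i; rewrite -N0 /B (@le_trans _ _ b0) ?lerDl//.
    by rewrite /b0 (bigD1 i)//= lerDl sumr_ge0.
  rewrite leq_eqVlt => /predU1P[<- i|].
    rewrite /B (@le_trans _ _ b0) ?lerDl//.
    by rewrite /b0 (bigD1 i)//= lerDl sumr_ge0.
  rewrite ltnS => Nt i.
  have := DS t B (IH Nt) i => /le_trans; apply.
  have /andP[a0 a1] := al01 i t.
  have h1 : (1 - al t i) * `|D t i| <= (1 - al t i) * B.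
    by rewrite ler_wpM2l ?subr_ge0// IH.
  have h2 : al t i * (gamma * (B + eta t)) <= al t i * B.
    rewrite ler_wpM2l// (le_trans _ gB)// ler_wpM2l// lerD2l.
    exact: eN.
  lra.
(* An eventual bound [c] feeds the recursion with targets below [gamma * c + e / 2];
   [averaging_near_le] costs the other half of [e]. *)
have step (c e : R) : P c -> 0 < e -> P (gamma * c + e).
  move=> [c_ge0 Pc] e0; split; first by rewrite addr_ge0 ?mulr_ge0// ltW.
  apply: filter_forall => i.
  have e2 : 0 < e / 2 by lra.
  have := @averaging_near_le (al^~ i) (fun t => `|D t i|)
    (gamma * c + e / 2) (al01 i) (dal i).
  have H : \forall t \near \oo, `|D t.+1 i| <=
      (1 - al t i) * `|D t i| + al t i * (gamma * c + e / 2).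
    have := near_eta _ e2; apply: filterS2 Pc => t Dc et.
    have /andP[a0 a1] := al01 i t.
    apply: (le_trans (DS t c Dc i)); rewrite lerD2l ler_wpM2l//.
    rewrite mulrDr lerD2l (@le_trans _ _ (gamma * (e / 2)))//.
      by rewrite ler_wpM2l.
    by rewrite ler_piMl// ltW.
  by move=> /(_ H _ e2); apply: filterS => t; lra.
have Psub : has_inf [set c | P c].
  by split; [exists c0|exists 0 => c []].
pose L := inf [set c | P c].
have L0 : 0 <= L by apply: lb_le_inf; [exists c0|move=> c []].
have LE : L = 0.
  apply/eqP; rewrite eq_le L0 andbT leNgt; apply/negP => Lp.
  (* A bound [c < L + e] improves to [gamma * c + e <= gamma * L + 2 * e], which is below [L] by
     [(1 - gamma) * L / 2], against the choice of [L]. *)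
  pose e := (1 - gamma) * L / 4.
  have e0 : 0 < e by rewrite divr_gt0// mulr_gt0// subr_gt0.
  have [c Pc cL] := inf_adherent e0 Psub.
  have := step c e Pc e0.
  move=> /(ge_inf Psub.2) h.
  have : gamma * c <= gamma * (L + e) by rewrite ler_wpM2l// ltW.
  have : gamma * e <= e by rewrite ler_piMl// ltW.
  rewrite -/L in cL h *; move: e0 h; rewrite /e; lra.
apply/cvgr0Pnorm_le => e e0.
have [c [_ Pc] cL] := inf_adherent e0 Psub.
apply: filterS Pc => t /(_ i0) /le_trans; apply.
by rewrite -/L LE add0r in cL; exact: ltW.
Qed.

End averaging_recursions.

(** * Measurability with respect to a sub-sigma-algebra *)

Section sub_sigma_algebra.
Context {R : realType} d {Omega : measurableType d}.
Implicit Types (G H : set (set Omega)) (X Y : Omega -> R).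

(** The sigma-algebra is a plain family of sets, so that all members of a filtration live on the
    same type [Omega]. *)
Definition wrt_measurable G Y := forall B : set R, measurable B -> G (Y @^-1` B).

(** A sigma-algebra generates itself; through this the closure properties below are inherited from
    ordinary measurable functions. *)
Lemma wrt_measurableP G Y : sigma_algebra setT G ->
  wrt_measurable G Y <->
  measurable_fun [set: g_sigma_algebraType G] (Y : g_sigma_algebraType G -> R).
Proof.
move=> sG; split=> [GY _ B mB|mY B mB].
  by rewrite setTI measurable_g_measurableTypeE//; exact: GY.
rewrite -[X in X _](measurable_g_measurableTypeE sG) -[_ @^-1` _]setTI.
exact: mY.
Qed.

Lemma wrt_measurable_sub G H Y : G `<=` H ->
  wrt_measurable G Y -> wrt_measurable H Y.
Proof. by move=> GH GY B mB; apply/GH/GY. Qed.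

Lemma wrt_measurable_fun G Y : G `<=` measurable ->
  wrt_measurable G Y -> measurable_fun setT Y.
Proof. by move=> Gm GY _ B mB; rewrite setTI; apply/Gm/GY. Qed.

Section closure.
Variable G : set (set Omega).
Hypothesis sG : sigma_algebra setT G.

Lemma wrt_measurable_cst c : wrt_measurable G (cst c).
Proof. by apply/wrt_measurableP => //; exact: measurable_cst. Qed.

Lemma wrt_measurableD X Y : wrt_measurable G X -> wrt_measurable G Y ->
  wrt_measurable G (fun w => X w + Y w).
Proof.
move=> /(wrt_measurableP _ sG) mX /(wrt_measurableP _ sG) mY.
by apply/wrt_measurableP => //; exact: measurable_funD.
Qed.

Lemma wrt_measurableM X Y : wrt_measurable G X -> wrt_measurable G Y ->
  wrt_measurable G (fun w => X w * Y w).
Proof.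
move=> /(wrt_measurableP _ sG) mX /(wrt_measurableP _ sG) mY.
by apply/wrt_measurableP => //; exact: measurable_funM.
Qed.

Lemma wrt_measurableB X Y : wrt_measurable G X -> wrt_measurable G Y ->
  wrt_measurable G (fun w => X w - Y w).
Proof.
move=> /(wrt_measurableP _ sG) mX /(wrt_measurableP _ sG) mY.
by apply/wrt_measurableP => //; exact: measurable_funB.
Qed.

Lemma wrt_measurable_sum (I : Type) (s : seq I) (X : I -> Omega -> R) :
  (forall i, wrt_measurable G (X i)) ->
  wrt_measurable G (fun w => \sum_(i <- s) X i w).
Proof.
move=> mX; elim: s => [|i s IH].
  under [X in wrt_measurable _ X]eq_fun do rewrite big_nil.
  exact: wrt_measurable_cst.
under [X in wrt_measurable _ X]eq_fun do rewrite big_cons.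
exact: wrt_measurableD.
Qed.

Lemma wrt_measurable_indic (E : set Omega) : G E -> wrt_measurable G (\1_E).
Proof.
move=> GE; apply/wrt_measurableP => //.
apply: (@measurable_indic _ (g_sigma_algebraType G)).
by rewrite measurable_g_measurableTypeE.
Qed.

Lemma wrt_measurable_ge Y c : wrt_measurable G Y -> G [set w | c <= Y w].
Proof.
move=> GY; have := GY `[c, +oo[%classic (measurable_itv _).
by congr G; apply/seteqP; split => w /=; rewrite in_itv/= andbT.
Qed.

Lemma wrt_measurable_le Y c : wrt_measurable G Y -> G [set w | Y w <= c].
Proof.
move=> GY; have := GY `]-oo, c]%classic (measurable_itv _).
by congr G; apply/seteqP; split => w /=; rewrite in_itv/=.
Qed.

Lemma wrt_measurable_norm_lt Y c : wrt_measurable G Y -> G [set w | `|Y w| < c].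
Proof.
move=> GY; have := GY `]-c, c[%classic (measurable_itv _).
by congr G; apply/seteqP; split => w /=; rewrite in_itv/= -ltr_norml.
Qed.

Lemma wrt_measurable_comp (f : R -> R) Y : measurable_fun setT f ->
  wrt_measurable G Y -> wrt_measurable G (f \o Y).
Proof.
by move=> mf GY B mB; rewrite comp_preimage; apply: GY; rewrite -[_ @^-1` _]setTI; exact: mf.
Qed.

(** Such a function is a finite linear combination of the indicators of the level sets of [s]. *)
Lemma wrt_measurable_finite (T : finType) (s : Omega -> T) (f : T -> R) :
  (forall x, G [set w | s w = x]) -> wrt_measurable G (f \o s).
Proof.
move=> Gs; rewrite (_ : f \o s = fun w => \sum_x (f x * \1_[set v | s v = x] w)).
  apply: wrt_measurable_sum => x; apply: wrt_measurableM.
    exact: wrt_measurable_cst.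
  exact: wrt_measurable_indic.
apply/funext => w /=; rewrite (bigD1 (s w))//= indicE mem_set//= mulr1 big1 ?addr0// => x sx.
by rewrite indicE memNset ?mulr0//= => /eqP; rewrite eq_sym (negbTE sx).
Qed.

End closure.
End sub_sigma_algebra.

(** * Bounds on events extended to bounded measurable multipliers *)

Section bounded_multipliers.
Context {R : realType} d {Omega : measurableType d} (mu : probability Omega R).
Implicit Types (G : set (set Omega)) (h Y : Omega -> R) (c C : R).

Lemma integrable_mul_bounded h Y c : mu.-integrable setT (EFin \o h) ->
  measurable_fun setT Y -> (forall w, `|Y w| <= c) ->
  mu.-integrable setT (EFin \o (fun w => h w * Y w)).
Proof.
move=> ih mY Yc; have : mu.-integrable setT ((EFin \o h) \* (EFin \o Y))%E.
  apply: integrableMl => //; exists c; split; first exact: num_real.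
  by move=> M cM w _; apply: (le_trans (Yc w)); exact: ltW.
by congr (integrable _ _ _); apply/funext => w /=; rewrite EFinM.
Qed.

Lemma integrable_bounded Y c : measurable_fun setT Y ->
  (forall w, `|Y w| <= c) -> mu.-integrable setT (EFin \o Y).
Proof.
move=> mY Yc; apply: measurable_bounded_integrable => //.
  by apply: le_lt_trans (probability_le1 mu measurableT) _; exact: ltry.
exists c; split; first exact: num_real.
by move=> M cM w _; apply: (le_trans (Yc w)); exact: ltW.
Qed.

Lemma Rintegral_indicM h (E : set Omega) :
  \int[mu]_(w in E) h w = \int[mu]_w (h w * \1_E w).
Proof.
rewrite Rintegral_mkcond; apply: eq_Rintegral => w _.
by rewrite patchE indicE; case: ifPn => _; rewrite ?mulr1 ?mulr0.
Qed.

(* Halving: [Y] is [c / 2] times the indicator of [Y >= c / 2] plus a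
   multiplier bounded by [c / 2]. *)
Lemma Rintegral_multiplier_le0 G h Y c : sigma_algebra setT G ->
  G `<=` measurable -> mu.-integrable setT (EFin \o h) ->
  (forall E, G E -> \int[mu]_(w in E) h w <= 0) ->
  wrt_measurable G Y -> (forall w, 0 <= Y w <= c) ->
  \int[mu]_w (h w * Y w) <= 0.
Proof.
move=> sG Gm ih hE GY Yc.
have normY (Z : Omega -> R) (b : R) : (forall w, 0 <= Z w <= b) -> forall w, `|Z w| <= b.
  by move=> Zb w; have /andP[Z0 ?] := Zb w; rewrite ger0_norm.
(* Each halving splits off an indicator part that contributes at most zero by [hE]; after [n] of
   them the remaining multiplier is at most [b / 2 ^+ n]. *)
have bound n : forall (Z : Omega -> R) (b : R), wrt_measurable G Z ->
    (forall w, 0 <= Z w <= b) ->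
    \int[mu]_w (h w * Z w) <= b / 2 ^+ n * \int[mu]_w `|h w|.
  elim: n => [|n IH] Z b GZ Zb.
    rewrite expr0 divr1 -RintegralZl//; last exact: integrable_norm.
    apply: le_Rintegral => //.
    - apply: integrable_mul_bounded (normY _ _ Zb) => //.
      exact: wrt_measurable_fun GZ.
    - have := integrable_norm ih => /(integrableZl measurableT b).
      by congr (integrable _ _ _); apply/funext => w /=; rewrite EFinM.
    - move=> w _; rewrite (le_trans (ler_norm _))// normrM mulrC.
      by rewrite ler_wpM2r// normY.
  pose E := [set w | b / 2 <= Z w].
  have GE : G E by exact: wrt_measurable_ge.
  pose Z' w := Z w - b / 2 * \1_E w.
  have GZ' : wrt_measurable G Z'.
    apply: wrt_measurableB => //; apply: wrt_measurableM => //.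
      exact: wrt_measurable_cst.
    exact: wrt_measurable_indic.
  have Z'b w : 0 <= Z' w <= b / 2.
    rewrite /Z' indicE; have := Zb w.
    have [Ew|nEw] := boolP (w \in E).
      by move: Ew; rewrite inE /E/=; lra.
    by move: nEw; rewrite notin_setE /E/= => /negP; rewrite -ltNge; lra.
  have ihE : mu.-integrable setT (EFin \o (fun w => h w * \1_E w)).
    apply: (@integrable_mul_bounded _ _ 1) => //.
      by apply: measurable_indic; exact: Gm.
    by move=> w; rewrite indicE; case: (w \in E); rewrite ?normr1 ?normr0.
  have ihZ' : mu.-integrable setT (EFin \o (fun w => h w * Z' w)).
    apply: integrable_mul_bounded (normY _ _ Z'b) => //.
    exact: wrt_measurable_fun GZ'.
  rewrite (_ : \int[mu]_w (h w * Z w) =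
     \int[mu]_w (b / 2 * (h w * \1_E w) + h w * Z' w)); last first.
    by apply: eq_Rintegral => w _; rewrite /Z'; ring.
  rewrite RintegralD//; last first.
    have := integrableZl measurableT (b / 2) ihE.
    by congr (integrable _ _ _); apply/funext => w /=; rewrite EFinM.
  rewrite RintegralZl// -Rintegral_indicM.
  (* The sign of [b] is read off at the default point of [Omega]. *)
  have b0 : 0 <= b / 2.
    by have /andP[Z0 /(le_trans Z0) b0] := Zb point; rewrite divr_ge0.
  have : b / 2 * \int[mu]_(w in E) h w <= 0 by rewrite mulr_ge0_le0// hE.
  have := IH Z' (b / 2) GZ' Z'b.
  have -> : b / 2 / 2 ^+ n = b / 2 ^+ n.+1 by rewrite exprS; field; rewrite expf_neq0.
  lra.
rewrite leNgt; apply/negP => I0.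
set I := \int[mu]_w (h w * Y w) in I0.
pose K := c * \int[mu]_w `|h w|.
have IK n : I * 2 ^+ n <= K.
  by have := bound n _ _ GY Yc; rewrite mulrAC -/I -/K ler_pdivlMr// exprn_gt0.
(* A positive [I] would satisfy [2 ^+ n <= K / I] for all [n], which fails at this integer because
   [n < 2 ^+ n]. *)
have : K / I < (Num.truncn (K / I)).+1%:R by exact: truncnS_gt.
rewrite ltr_pdivrMr//; apply/negP; rewrite -leNgt.
apply: le_trans (IK (Num.truncn (K / I)).+1); rewrite mulrC ler_pM2l//.
by rewrite -natrX ler_nat ltnW// ltn_expl.
Qed.

(** The hypothesis on events expresses that the conditional expectation of [h] given [G] is at most
    [C]. The previous lemma applies to [h - C]. *)
Lemma Rintegral_multiplier_le G h Y c C : sigma_algebra setT G ->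
  G `<=` measurable -> mu.-integrable setT (EFin \o h) ->
  (forall E, G E -> \int[mu]_(w in E) h w <= C * fine (mu E)) ->
  wrt_measurable G Y -> (forall w, 0 <= Y w <= c) ->
  \int[mu]_w (h w * Y w) <= C * \int[mu]_w Y w.
Proof.
move=> sG Gm ih hE GY Yc.
have Yn w : `|Y w| <= c by have /andP[Y0 ?] := Yc w; rewrite ger0_norm.
have mY := wrt_measurable_fun Gm GY.
have iY := integrable_bounded mY Yn.
have iC (E : set Omega) : measurable E -> mu.-integrable E (EFin \o cst C).
  by move=> mE; exact: finite_measure_integrable_cst.
have ihC : mu.-integrable setT (EFin \o (fun w => h w - C)).
  have := integrableB measurableT ih (iC _ measurableT).
  by congr (integrable _ _ _); apply/funext => w /=; rewrite EFinB.
have : \int[mu]_w ((h w - C) * Y w) <= 0.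
  apply: (@Rintegral_multiplier_le0 G _ _ c) => // E GE.
  have mE := Gm _ GE.
  have ihE := integrableS measurableT mE (@subsetT _ E) ih.
  rewrite (RintegralB mE ihE (iC _ mE)).
  by rewrite Rintegral_cst// subr_le0 hE.
rewrite (_ : \int[mu]_w ((h w - C) * Y w) = \int[mu]_w (h w * Y w - C * Y w)).
  rewrite RintegralB//.
  - by rewrite RintegralZl// subr_le0.
  - exact: integrable_mul_bounded Yn.
  - have := integrableZl measurableT C iY.
    by congr (integrable _ _ _); apply/funext => w /=; rewrite EFinM.
by apply: eq_Rintegral => w _; rewrite mulrBl.
Qed.

(** The shift [Y + c] is a nonnegative multiplier and leaves the integral unchanged, as [h] has mean
    zero. The one-sided lemma then applies to [h] and to [- h]. *)
Lemma Rintegral_multiplier_eq0 G h Y c : sigma_algebra setT G ->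
  G `<=` measurable -> mu.-integrable setT (EFin \o h) ->
  (forall E, G E -> \int[mu]_(w in E) h w = 0) ->
  wrt_measurable G Y -> (forall w, `|Y w| <= c) ->
  \int[mu]_w (h w * Y w) = 0.
Proof.
move=> sG Gm ih hE GY Yc.
have mY := wrt_measurable_fun Gm GY.
have ihY := integrable_mul_bounded ih mY Yc.
have ihc : mu.-integrable setT (EFin \o (fun w => c * h w)).
  have := integrableZl measurableT c ih.
  by congr (integrable _ _ _); apply/funext => w /=; rewrite EFinM.
have ishift : mu.-integrable setT (EFin \o (fun w => h w * (Y w + c))).
  have := integrableD measurableT ihY ihc.
  by congr (integrable _ _ _); apply/funext => w /=; rewrite -EFinD; congr EFin; ring.
have Gc : wrt_measurable G (fun w => Y w + c).
  by apply: wrt_measurableD => //; exact: wrt_measurable_cst.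
have Ycb w : 0 <= Y w + c <= c + c by have := Yc w; rewrite ler_norml; lra.
have GT : G setT by rewrite -(setD0 setT); case: sG => G0 GD _; exact: GD.
have h0 : \int[mu]_w h w = 0 by exact: hE.
have E : \int[mu]_w (h w * (Y w + c)) = \int[mu]_w (h w * Y w).
  rewrite (_ : \int[mu]_w (h w * (Y w + c)) = \int[mu]_w (h w * Y w + c * h w)).
    by rewrite RintegralD// RintegralZl// h0 mulr0 addr0.
  by apply: eq_Rintegral => w _; ring.
apply/eqP; rewrite -E eq_le; apply/andP; split.
  by apply: (@Rintegral_multiplier_le0 G _ _ (c + c)) => // A GA; rewrite hE.
rewrite -oppr_le0 -mulN1r -RintegralZl//.
rewrite (_ : Rintegral _ _ _ = \int[mu]_w (- h w * (Y w + c))); last first.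
  by apply: eq_Rintegral => w _; ring.
apply: (@Rintegral_multiplier_le0 G _ _ (c + c)) => //.
  have := integrableN ih.
  by congr (integrable _ _ _); apply/funext => w /=; rewrite EFinN.
move=> A GA; rewrite (_ : Rintegral _ _ _ = \int[mu]_(w in A) (-1 * h w)).
  rewrite RintegralZl ?hE ?mulr0//; first exact: Gm.
  by apply: integrableS ih => //; exact: Gm.
by apply: eq_Rintegral => w _; rewrite mulN1r.
Qed.

End bounded_multipliers.

(** * Almost sure convergence of weighted martingale noise *)

Section martingale_noise.
Context {R : realType} d {Omega : measurableType d} (mu : probability Omega R).
Variables (F : nat -> set (set Omega)) (xi : nat -> Omega -> R) (C : R).
Hypothesis F_sigma : forall t, sigma_algebra setT (F t).
Hypothesis F_measurable : forall t, F t `<=` measurable.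
Hypothesis F_mono : forall t, F t `<=` F t.+1.
Hypothesis C_ge0 : 0 <= C.
Hypothesis xi_adapted : forall t, wrt_measurable (F t.+1) (xi t).
Hypothesis xi_integrable : forall t, mu.-integrable setT (EFin \o xi t).
Hypothesis xi2_integrable :
  forall t, mu.-integrable setT (EFin \o (fun w => xi t w ^+ 2)).
(** Tested on the events of [F t], this and the next hypothesis give [xi t] conditional mean zero
    and conditional second moment at most [C]. *)
Hypothesis xi_centered : forall t E, F t E -> \int[mu]_(w in E) xi t w = 0.
Hypothesis xi_variance : forall t E, F t E ->
  \int[mu]_(w in E) (xi t w ^+ 2) <= C * fine (mu E).

Section square_summable_weights.
Variables (be : nat -> Omega -> R) (k : R).
Hypothesis be_adapted : forall t, wrt_measurable (F t) (be t).
Hypothesis be01 : forall t w, 0 <= be t w <= 1.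
Hypothesis be_sum2 : forall T w, \sum_(0 <= t < T) be t w ^+ 2 <= k.

(* The sum of [be t * xi t] over [N <= t], frozen once it leaves [-lam, lam]. *)
Fixpoint stopped_sum (N : nat) (lam : R) (t : nat) : Omega -> R :=
  if t is t'.+1 then
    let z := stopped_sum N lam t' in
    fun w => z w +
      xi t' w * (be t' w * ((N <= t')%N%:R * \1_[set v | `|z v| < lam] w))
  else cst 0.

(** This is the factor that [xi t] carries in [stopped_sum]. It is already known at time [t], so the
    multiplier lemmas apply to it. *)
Definition stopped_weight N lam t (w : Omega) : R :=
  be t w * ((N <= t)%N%:R * \1_[set v | `|stopped_sum N lam t v| < lam] w).

Lemma stopped_sum_weight_measurable N lam t :
  wrt_measurable (F t) (stopped_sum N lam t) /\
  wrt_measurable (F t) (stopped_weight N lam t).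
Proof.
suff H : wrt_measurable (F t) (stopped_sum N lam t).
  split => //; apply: wrt_measurableM => //; apply: wrt_measurableM => //.
    exact: wrt_measurable_cst.
  by apply: wrt_measurable_indic => //; exact: wrt_measurable_norm_lt.
elim: t => [|t IH]; first exact: wrt_measurable_cst.
apply: wrt_measurableD => //; first exact: wrt_measurable_sub IH.
apply: wrt_measurableM => //.
apply: (wrt_measurable_sub (@F_mono t)).
apply: wrt_measurableM => //; apply: wrt_measurableM => //.
  exact: wrt_measurable_cst.
by apply: wrt_measurable_indic => //; exact: wrt_measurable_norm_lt.
Qed.

Lemma stopped_weight_bound N lam t w : 0 <= stopped_weight N lam t w <= be t w.
Proof.
have /andP[b0 b1] := be01 t w.
rewrite /stopped_weight indicE -natrM; set n := (_ * _)%N.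
have n1 : (n <= 1)%N by rewrite /n mulnb; exact: leq_b1.
by rewrite mulr_ge0//= ler_piMr// (ler_nat _ n 1).
Qed.

(** The last jump may carry the stopped sum far beyond [lam], but there the weight vanishes. So the
    cross term of the squared sum has a bounded multiplier. *)
Lemma stopped_sum_mul_weight_bound N lam t w : 0 <= lam ->
  `|stopped_sum N lam t w * stopped_weight N lam t w| <= lam.
Proof.
move=> l0; have /andP[g0 gb] := stopped_weight_bound N lam t w.
have /andP[b0 b1] := be01 t w.
rewrite normrM (ger0_norm g0); move: g0 gb; rewrite /stopped_weight indicE.
have [|] := boolP (w \in _); last by rewrite !mulr0.
rewrite inE /= => zl _ gb.
rewrite -[leRHS]mulr1 ler_pM//; last exact: le_trans b1.
- by rewrite mulr_ge0.
- exact: ltW.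
Qed.

(** Orthogonality of increments: on expanding the square of one step, the cross term integrates to
    zero and the last term adds at most [C] times the second moment of [be t]. Integrability is
    carried along the induction. *)
Lemma stopped_sum_sq N lam t : 0 <= lam ->
  mu.-integrable setT (EFin \o (fun w => stopped_sum N lam t w ^+ 2)) /\
  \int[mu]_w (stopped_sum N lam t w ^+ 2) <=
    C * \sum_(N <= i < t) \int[mu]_w (be i w ^+ 2).
Proof.
move=> l0; elim: t => [|t [IHi IH]].
  split.
    rewrite (_ : EFin \o _ = EFin \o cst 0); last by apply/funext => w /=; rewrite expr0n.
    exact: finite_measure_integrable_cst.
  rewrite (_ : Rintegral _ _ _ = \int[mu]_(w in setT) (0 : R)); last first.
    by apply: eq_Rintegral => w _ /=; rewrite expr0n.
  rewrite Rintegral_cst// mul0r mulr_ge0// sumr_ge0// => i _.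
  by apply: Rintegral_ge0 => w _; exact: sqr_ge0.
have [mz mg] := stopped_sum_weight_measurable N lam t.
set z := stopped_sum N lam t in mz IHi IH *; set g := stopped_weight N lam t in mg *.
have gb w : 0 <= g w <= be t w by exact: stopped_weight_bound.
have zE w : stopped_sum N lam t.+1 w ^+ 2 =
    z w ^+ 2 + 2 * (xi t w * (z w * g w)) + xi t w ^+ 2 * (g w * g w).
  have -> : stopped_sum N lam t.+1 w = z w + xi t w * g w by [].
  by ring.
have mzg : wrt_measurable (F t) (fun w => z w * g w) by exact: wrt_measurableM.
have zgl w : `|z w * g w| <= lam by exact: stopped_sum_mul_weight_bound.
have mgg : wrt_measurable (F t) (fun w => g w * g w) by exact: wrt_measurableM.
have gg01 w : 0 <= g w * g w <= 1.
  have /andP[g0 gbe] := gb w; have /andP[b0 b1] := be01 t w.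
  by rewrite mulr_ge0//= mulr_ile1// (le_trans gbe).
have ggn w : `|g w * g w| <= 1 by have /andP[? ?] := gg01 w; rewrite ger0_norm.
have i2 : mu.-integrable setT (EFin \o (fun w => xi t w * (z w * g w))).
  apply: integrable_mul_bounded zgl => //.
  exact: wrt_measurable_fun mzg.
have i2' : mu.-integrable setT (EFin \o (fun w => 2 * (xi t w * (z w * g w)))).
  have := integrableZl measurableT 2 i2.
  by congr (integrable _ _ _); apply/funext => w /=; rewrite EFinM.
have i3 : mu.-integrable setT (EFin \o (fun w => xi t w ^+ 2 * (g w * g w))).
  apply: integrable_mul_bounded ggn => //.
  exact: wrt_measurable_fun mgg.
have i12 : mu.-integrable setT
    (EFin \o (fun w => z w ^+ 2 + 2 * (xi t w * (z w * g w)))).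
  have := integrableD measurableT IHi i2'.
  by congr (integrable _ _ _); apply/funext => w /=; rewrite EFinD.
split.
  have := integrableD measurableT i12 i3.
  by congr (integrable _ _ _); apply/funext => w /=; rewrite -EFinD -zE.
rewrite (_ : Rintegral _ _ _ = \int[mu]_w (z w ^+ 2 + 2 * (xi t w * (z w * g w))
   + xi t w ^+ 2 * (g w * g w))); last by apply: eq_Rintegral => w _; exact: zE.
rewrite RintegralD// RintegralD// RintegralZl//.
rewrite (@Rintegral_multiplier_eq0 _ _ _ _ (F t) _ _ lam)//; last exact: xi_centered.
rewrite mulr0 addr0.
have le3 : \int[mu]_w (xi t w ^+ 2 * (g w * g w)) <= C * \int[mu]_w (g w * g w).
  by apply: (@Rintegral_multiplier_le _ _ _ _ (F t) _ _ 1) => // E FE; exact: xi_variance.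
have [Nt|tN] := leqP N t.
  rewrite big_nat_recr//= mulrDr lerD// (le_trans le3)// ler_wpM2l//.
  apply: le_Rintegral => //.
  - by apply: integrable_bounded ggn => //; exact: wrt_measurable_fun mgg.
  - apply: (@integrable_bounded _ _ _ _ _ 1).
      apply: (@wrt_measurable_fun _ _ _ (F t)) => //.
      by under [X in wrt_measurable _ X]eq_fun do rewrite expr2; exact: wrt_measurableM.
    move=> w; have /andP[b0 b1] := be01 t w.
    by rewrite ger0_norm ?sqr_ge0// expr_le1.
  - by move=> w _; have /andP[g0 gbe] := gb w; rewrite expr2 ler_pM.
(* Before time [N] the weight is zero, and both index ranges are empty. *)
have g0 w : g w = 0 by rewrite /g /stopped_weight leqNgt tN mul0r mulr0.
rewrite (_ : \int[mu]_w (g w * g w) = 0) ?mulr0 in le3; last first.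
  rewrite (_ : Rintegral _ _ _ = \int[mu]_(w in setT) (0 : R)).
    by rewrite Rintegral_cst// mul0r.
  by apply: eq_Rintegral => w _; rewrite g0 mulr0.
move: IH; rewrite !big_geq//; last exact: ltnW.
lra.
Qed.

Definition escape_set N lam t : set Omega := [set w | lam <= `|stopped_sum N lam t w|].

Lemma measurable_escape_set N lam t : measurable (escape_set N lam t).
Proof.
apply: (F_measurable (t := t)).
have [mz _] := stopped_sum_weight_measurable N lam t.
have -> : escape_set N lam t = setT `\` [set w | `|stopped_sum N lam t w| < lam].
  apply/seteqP; split => w /=; rewrite /escape_set/=.
    by move=> h; split => //; apply/negP; rewrite -leNgt.
  by move=> [_ /negP]; rewrite -leNgt.
have [_ FD _] := F_sigma t; apply: FD; exact: wrt_measurable_norm_lt.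
Qed.

(** A frozen sum stays outside, so an escape at any earlier time is visible at time [t]. *)
Lemma nondecreasing_escape_set N lam : nondecreasing_seq (escape_set N lam).
Proof.
apply/nondecreasing_seqP => t; apply/subsetPset => w /=.
rewrite /escape_set /= => h.
by rewrite indicE memNset ?mulr0 ?addr0//=; apply/negP; rewrite -leNgt.
Qed.

Lemma stopped_sum_no_escape N lam w :
  (forall t, `|stopped_sum N lam t w| < lam) ->
  forall t, (N <= t)%N ->
  stopped_sum N lam t w = \sum_(N <= i < t) be i w * xi i w.
Proof.
move=> nesc.
have z0 t : (t <= N)%N -> stopped_sum N lam t w = 0.
  by elim: t => //= t IH tN; rewrite IH ?(ltnW tN)// leqNgt tN mul0r !mulr0 addr0.
elim=> [|t IH]; first by rewrite leqn0 => /eqP ->; rewrite big_geq.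
rewrite leq_eqVlt => /predU1P[Nt|]; first by rewrite -Nt z0// big_geq.
rewrite ltnS => Nt; rewrite big_nat_recr//= IH// Nt mul1r.
by rewrite indicE mem_set ?mulr1 1?mulrC//=; exact: nesc.
Qed.

(** Thanks to the freezing, Chebyshev's inequality at the single time [t] is Kolmogorov's maximal
    inequality up to [t]. *)
Lemma chebyshev_escape_set N lam t : 0 <= lam ->
  lam ^+ 2 * fine (mu (escape_set N lam t)) <=
    C * \sum_(N <= i < t) \int[mu]_w (be i w ^+ 2).
Proof.
move=> l0; have [iz bz] := stopped_sum_sq N t l0.
have mE := measurable_escape_set N lam t.
apply: le_trans bz; rewrite -Rintegral_cst// Rintegral_indicM.
apply: le_Rintegral => //.
- have := integrableZl measurableT (lam ^+ 2) (integrable_indic mu mE).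
  by congr (integrable _ _ _); apply/funext => w /=; rewrite EFinM.
- move=> w _; rewrite indicE; have [|_] := boolP (w \in _).
    rewrite inE /escape_set/= => h; rewrite mulr1 -[leRHS]real_normK ?num_real//.
    by rewrite lerXn2r// nnegrE.
  by rewrite mulr0 sqr_ge0.
Qed.

(** The pathwise bound [k] integrates to a bound on the sum of second moments, and [N] is an index
    where the partial sums come within [e] of their supremum. *)
Lemma weight_tail (e : R) : 0 < e ->
  exists N, forall t, \sum_(N <= i < t) \int[mu]_w (be i w ^+ 2) <= e.
Proof.
move=> e0; pose b i := \int[mu]_w (be i w ^+ 2).
have b0 i : 0 <= b i by apply: Rintegral_ge0 => w _; exact: sqr_ge0.
have ib i : mu.-integrable setT (EFin \o (fun w => be i w ^+ 2)).
  apply: (@integrable_bounded _ _ _ _ _ 1).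
    apply: (@wrt_measurable_fun _ _ _ (F i)) => //.
    by under [X in wrt_measurable _ X]eq_fun do rewrite expr2; exact: wrt_measurableM.
  move=> w; have /andP[? ?] := be01 i w.
  by rewrite ger0_norm ?sqr_ge0// expr_le1.
have bsum T : mu.-integrable setT (EFin \o (fun w => \sum_(0 <= i < T) be i w ^+ 2)) /\
   \int[mu]_w (\sum_(0 <= i < T) be i w ^+ 2) = series b T.
  elim: T => [|T [IHi IH]].
    split.
      rewrite (_ : EFin \o _ = EFin \o cst 0); last by apply/funext => w /=; rewrite big_geq.
      exact: finite_measure_integrable_cst.
    rewrite (_ : Rintegral _ _ _ = \int[mu]_(w in setT) (0 : R)).
      by rewrite Rintegral_cst// mul0r /series/= big_geq.
    by apply: eq_Rintegral => w _; rewrite big_geq.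
  split.
    have := integrableD measurableT IHi (ib T).
    by congr (integrable _ _ _); apply/funext => w /=; rewrite -EFinD big_nat_recr.
  rewrite seriesSr -IH -RintegralD//.
  by apply: eq_Rintegral => w _; rewrite big_nat_recr.
have nb : nondecreasing_seq (series b) by apply: nondecreasing_series.
have ubb : has_ubound (range (series b)).
  exists k => _ [T _ <-]; have [iT <-] := bsum T.
  rewrite -[leRHS]mulr1 -[in leRHS](_ : fine (mu setT) = 1); last by rewrite probability_setT.
  rewrite -Rintegral_cst//; apply: le_Rintegral => //.
  exact: finite_measure_integrable_cst.
have hs : has_sup (range (series b)) by split => //; exists (series b 0), 0%N.
have [_ [N _ <-] hN] := sup_adherent e0 hs.
exists N => t; have [Nt|tN] := leqP N t; last by rewrite big_geq ?ltW// ltnW.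
rewrite -sub_series_geq// lerBlDr.
have : series b t <= sup (range (series b)) by apply: ub_le_sup => //; exists t.
lra.
Qed.

(** The exceptional paths escape for every starting index [N]; the maximal inequality bounds the
    probability of this by a tail of the second moments. *)
Lemma ae_weighted_noise_small (lam : R) : 0 < lam ->
  {ae mu, forall w, exists N, forall t, `|stopped_sum N lam t w| < lam}.
Proof.
move=> l0; exists (\bigcap_N \bigcup_t escape_set N lam t).
have mU N : measurable (\bigcup_t escape_set N lam t).
  by apply: bigcup_measurable => t _; exact: measurable_escape_set.
have mI : measurable (\bigcap_N \bigcup_t escape_set N lam t).
  exact: bigcap_measurableType.
split => //.
  apply/eqP; rewrite -measure_le0; apply/lee_addgt0Pr => e e0; rewrite add0e.
  have C1 : 0 < C + 1 by rewrite ltr_wpDl.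
  (* With this tail, the maximal inequality gives probability at most [e * C / (C + 1) <= e]; the
     denominator [C + 1] also covers [C = 0]. *)
  have [N tailN] := @weight_tail (e * lam ^+ 2 / (C + 1)) (divr_gt0 (mulr_gt0 e0 (exprn_gt0 2 l0)) C1).
  apply: (@le_trans _ _ (mu (\bigcup_t escape_set N lam t))).
    by apply: le_measure; rewrite ?inE//; exact: bigcap_inf.
  have cv := nondecreasing_cvg_mu (measurable_escape_set N lam) (mU N)
    (@nondecreasing_escape_set N lam) (mu := mu).
  rewrite -(cvg_lim _ cv)//; apply: lime_le; first by apply/cvg_ex; eexists; exact: cv.
  apply: nearW => t /=.
  have fE : mu (escape_set N lam t) \is a fin_num.
    by apply: fin_num_measure; exact: measurable_escape_set.
  rewrite -(fineK fE) lee_fin -(ler_pM2l (exprn_gt0 2 l0)).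
  apply: (le_trans (chebyshev_escape_set N t (ltW l0))).
  apply: (@le_trans _ _ (C * (e * lam ^+ 2 / (C + 1)))); first by rewrite ler_wpM2l.
  rewrite mulrA ler_pdivrMr//.
  rewrite mulrC [in leRHS]mulrC [lam ^+ 2 * _]mulrC mulrDl mul1r.
  by rewrite [in leRHS]mulrC [e * lam ^+ 2 * C]mulrC lerDl ltW// mulr_gt0// exprn_gt0.
move=> w /= /forallNP h N _; have /existsNP[t /negP] := h N.
by rewrite -leNgt => ht; exists t.
Qed.

(** Cauchy criterion: a block of the series is a difference of two stopped sums that never escape.
    The countably many levels [m.+1%:R^-1] leave a single null set. *)
Lemma ae_cvg_square_summable :
  {ae mu, forall w, cvgn (series (fun t => be t w * xi t w))}.
Proof.
have := ae_foralln (fun m => @ae_weighted_noise_small m.+1%:R^-1 ltac:(by rewrite invr_gt0)).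
apply: filterS => w hw.
apply/cauchy_cvgP/cauchy_seriesP => e e0.
have e2 : 0 < e / 2 by lra.
pose m := Num.truncn (e / 2)^-1.
have lme : m.+1%:R^-1 < e / 2.
  rewrite invf_plt ?posrE//; exact: truncnS_gt.
have [N hN] := hw m.
have SN := stopped_sum_no_escape hN.
exists ([set n | (N <= n)%N], [set n | (N <= n)%N]); first by split; exists N.
move=> [p q] /= [Np Nq].
have [pq|qp] := leqP p q; last by rewrite big_geq ?normr0// ltnW.
have -> : \sum_(p <= i < q) be i w * xi i w =
    stopped_sum N m.+1%:R^-1 q w - stopped_sum N m.+1%:R^-1 p w.
  by rewrite !SN// [X in X - _](@big_cat_nat _ _ _ p)//= addrAC subrr add0r.
apply: (le_lt_trans (ler_normB _ _)).
by rewrite (splitr e) ltrD// (lt_trans (hN _)).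
Qed.

End square_summable_weights.

(* Weights whose squares are only almost surely summable are cut off once the
   sum of squares exceeds the integer [k]. *)
Lemma ae_cvg_weighted_noise (al : nat -> Omega -> R) :
  (forall t, wrt_measurable (F t) (al t)) ->
  {ae mu, forall w, (forall t, 0 <= al t w <= 1) /\
     exists k : R, forall T, \sum_(0 <= t < T) al t w ^+ 2 <= k} ->
  {ae mu, forall w, cvgn (series (fun t => al t w * xi t w))}.
Proof.
move=> al_adapted al_ae.
(* Clipping enforces the bounds on every path and changes nothing on the paths where they already
   hold. *)
pose clip (x : R) := Num.max 0 (Num.min x 1).
have mclip : measurable_fun setT clip.
  by apply: measurable_maxr; [exact: measurable_cst|
    apply: measurable_minr; [exact: measurable_id|exact: measurable_cst]].
have clip01 x : 0 <= clip x <= 1 by rewrite /clip; case: (ltP x 1) => ?; case: (ltP 0 _); lra.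
have clipid x : 0 <= x <= 1 -> clip x = x.
  by rewrite /clip; case: (ltP x 1) => ?; case: (ltP 0 _); lra.
(* The current square is included: the cutoff is still known at time [t], and the retained squares
   never sum to more than [k]. *)
pose S t w : R := \sum_(0 <= i < t.+1) clip (al i w) ^+ 2.
pose be (k : R) t w : R := clip (al t w) * \1_[set v | S t v <= k] w.
have F_sub t i : (i <= t)%N -> F i `<=` F t.
  by elim: t => [|t IH]; [rewrite leqn0 => /eqP ->|
    rewrite leq_eqVlt => /predU1P[->//|/IH /subset_trans]; apply].
have clip_adapted t : wrt_measurable (F t) (fun w => clip (al t w)).
  exact: wrt_measurable_comp mclip (al_adapted t).
have S_adapted t : wrt_measurable (F t) (S t).
  rewrite /S; under [X in wrt_measurable _ X]eq_fun do rewrite big_mkord.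
  apply: wrt_measurable_sum => // i; apply: (wrt_measurable_sub (F_sub t i _)).
    by rewrite -ltnS.
  by under [X in wrt_measurable _ X]eq_fun do rewrite expr2; exact: wrt_measurableM.
have be_adapted (k : R) t : wrt_measurable (F t) (be k t).
  apply: wrt_measurableM => //; apply: wrt_measurable_indic => //.
  exact: wrt_measurable_le.
have be01 (k : R) t w : 0 <= be k t w <= 1.
  rewrite /be indicE; have /andP[c0 c1] := clip01 (al t w).
  by case: (w \in _); rewrite ?mulr1 ?mulr0 ?c0//= lexx ler01.
have be_sum2 (k : R) T w : 0 <= k -> \sum_(0 <= t < T) be k t w ^+ 2 <= k.
  move=> k0.
  (* The second bound strengthens the induction: when the weight at [T] is retained, [S T w <= k]
     controls all earlier squares at once. *)
  suff : \sum_(0 <= t < T) be k t w ^+ 2 <= k /\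
      \sum_(0 <= t < T) be k t w ^+ 2 <= \sum_(0 <= t < T) clip (al t w) ^+ 2 by case.
  elim: T => [|T [IH1 IH2]]; first by rewrite !big_geq.
  rewrite !big_nat_recr//= /be indicE; have [|_] := boolP (w \in _).
    rewrite inE /S /= big_nat_recr//= mulr1 => h.
    split; last by rewrite lerD2r.
    by apply: le_trans h; rewrite lerD2r.
  rewrite mulr0 expr0n/= addr0; split => //.
  by apply: (le_trans IH2); rewrite lerDl sqr_ge0.
have := ae_foralln (fun k => @ae_cvg_square_summable (be k%:R) k%:R
  (be_adapted _) (be01 _) (fun T w => be_sum2 k%:R T w (ler0n _ k))).
apply: filterS2 al_ae => w [al01 [b hb]] hk.
pose k := (Num.truncn b).+1.
have bk : b <= k%:R by apply: ltW; exact: truncnS_gt.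
rewrite (_ : (fun t => _) = fun t => be k%:R t w * xi t w); first exact: hk.
apply/funext => t.
rewrite /be clipid// indicE mem_set ?mulr1//= (le_trans _ bk)// (le_trans _ (hb t.+1))//.
by rewrite /S; apply: ler_sum => i _; rewrite clipid.
Qed.

End martingale_noise.

(* MathComp's order library has an unrelated [maxA] (associativity of [max]). *)
Local Notation maxA := Defs.maxA.

(** * The maximum over actions and the clipped target *)

Section maxA_theory.
Context {R : realType} {A : finType}.
Implicit Types f g : A -> R.

Lemma maxA_ge f b : f b <= maxA f.
Proof.
rewrite /maxA; case: pickP => [b0 _|/(_ b)//].
by rewrite (bigD1 b)//= le_max lexx.
Qed.

(** The action [b0] excludes the default value that [maxA] takes on an empty action set. *)
Lemma maxA_attained f (b0 : A) : exists b, maxA f = f b.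
Proof.
rewrite /maxA; case: pickP => [b1 _|/(_ b0)//].
elim/big_ind: _ => [|x y [b ->] [c ->]|b _]; [by exists b1| |by exists b].
by case: leP => _; [exists c|exists b].
Qed.

Lemma maxA_dist f g (b0 : A) (e : R) : (forall b, `|f b - g b| <= e) ->
  `|maxA f - maxA g| <= e.
Proof.
move=> fg; have [b fb] := maxA_attained f b0; have [c gc] := maxA_attained g b0.
rewrite ler_norml; have := fg b; have := fg c; rewrite !ler_norml.
have := maxA_ge f c; have := maxA_ge g b; rewrite fb gc.
by move=> ? ? /andP[? ?] /andP[? ?]; apply/andP; split; lra.
Qed.

(* [M_K] contains a maximiser of [qb], which is almost a maximiser of [qa]. *)
Lemma clipped_target_dist (K : nat) (sel : (A -> R) -> (A -> R) -> A)
    (qa qb : A -> R) (e : R) :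
  topK_argmax_rule K sel -> (forall b, `|qa b - qb b| <= e) ->
  `|Num.min (qb (sel qb qa)) (maxA qa) - maxA qa| <= 3 * e.
Proof.
move=> /(_ qb qa)[M [_ topM selM maxM]] ab.
set c := sel qb qa in selM maxM *.
have [b qbb] := maxA_attained qb c.
(* If the maximiser [b] lies outside [M], the top-K property makes [qb] at least as large at [c],
   which is in [M]. *)
have [b' b'M qbb'] : exists2 b', b' \in M & maxA qb = qb b'.
  have [bM|bM] := boolP (b \in M); first by exists b.
  exists c => //; apply/eqP; rewrite eq_le maxA_ge andbT qbb.
  exact: topM.
have [m qam] := maxA_attained qa c.
have h1 := maxM _ b'M; have h2 := maxA_ge qb m; have h3 := maxA_ge qa c.
have := ab c; have := ab m; have := ab b'; rewrite !ler_norml qbb' in h2 *.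
rewrite qam in h3 *.
move=> /andP[? ?] /andP[? ?] /andP[? ?].
(* The lower bound is the chain [qb c >= qa c - e >= qa b' - e >= qb b' - 2 * e >= qb m - 2 * e >=
   qa m - 3 * e]; three changes of table give the factor 3. *)
by have [?|?] := leP (qb c) (qa m); apply/andP; split; lra.
Qed.

End maxA_theory.

(** * Comparison with the oracle scheme on a fixed path *)

Section pathwise_convergence.
Context {R : realType} {S A : finType} {Omega : Type}.
Variables (gamma : R) (K : nat) (sel : (A -> R) -> (A -> R) -> A).
Variables (Qstar QA0 QB0 : S -> A -> R).
Variables (s : nat -> Omega -> S) (a : nat -> Omega -> A) (r : nat -> Omega -> R).
Variables (alpha : nat -> S -> A -> Omega -> R) (w : Omega).
Hypothesis gamma01 : 0 <= gamma < 1.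
Hypothesis sel_rule : topK_argmax_rule K sel.
Hypothesis alpha01 : forall x y t, 0 <= alpha t x y w <= 1.
Hypothesis alpha_div : forall x y, sum_diverges (fun t => alpha t x y w).
Hypothesis alpha_supp :
  forall x y t, (x, y) <> (s t w, a t w) -> alpha t x y w = 0.

(** The sampled Bellman residual of [Qstar]: it depends on the trajectory only, not on the
    iterates. *)
Definition bellman_noise t (v : Omega) : R :=
  r t v + gamma * maxA (Qstar (s t.+1 v)) - Qstar (s t v) (a t v).

Hypothesis noise_cvg : forall x y,
  cvgn (series (fun t => alpha t x y w * bellman_noise t w)).

Let q t := acdq_iter gamma sel QA0 QB0 s r alpha t w.

Let target t : R := let s' := s t.+1 w in
  Num.min ((q t).2 s' (sel ((q t).2 s') ((q t).1 s'))) (maxA ((q t).1 s')).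

Lemma acdq_iterS1 t x y : (q t.+1).1 x y =
  (q t).1 x y + alpha t x y w * (r t w + gamma * target t - (q t).1 x y).
Proof. by rewrite /target /q /=; case: acdq_iter. Qed.

Lemma acdq_iterS2 t x y : (q t.+1).2 x y =
  (q t).2 x y + alpha t x y w * (r t w + gamma * target t - (q t).2 x y).
Proof. by rewrite /target /q /=; case: acdq_iter. Qed.

(** Both tables move towards the same target with the same step size, so the target cancels in the
    difference. *)
Lemma acdq_diff_cvg0 x y : (fun t => (q t).1 x y - (q t).2 x y) @ \oo --> 0.
Proof.
apply: (@averaging_cvg0 _ (fun t => alpha t x y w) _ (fun=> 0)) => //.
  by move=> t; rewrite acdq_iterS1 acdq_iterS2; ring.
exact: cvg_cst.
Qed.

(* The averaging scheme whose target uses [Qstar] instead of the current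
   estimates: its error is pure martingale noise, and it does not involve [sel]. *)
Fixpoint oracle_iter t : S -> A -> R :=
  if t is t'.+1 then fun x y => oracle_iter t' x y + alpha t' x y w *
    (r t' w + gamma * maxA (Qstar (s t'.+1 w)) - oracle_iter t' x y)
  else QA0.

Lemma oracle_error_cvg0 x y : (fun t => oracle_iter t x y - Qstar x y) @ \oo --> 0.
Proof.
apply: (@robbins_monro_cvg0 _ (fun t => alpha t x y w) _ (bellman_noise^~ w)) => // t /=.
(* The step size vanishes off the visited pair, so one noise sequence serves every coordinate. *)
have aQ : alpha t x y w * Qstar (s t w) (a t w) = alpha t x y w * Qstar x y.
  have [[-> ->]//|/eqP ne] := eqVneq (x, y) (s t w, a t w).
  by rewrite alpha_supp// !mul0r.
by rewrite /bellman_noise [X in _ = _ + X]mulrBr aQ; ring.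
Qed.

Lemma cvg_sum_norm0 (f : nat -> S * A -> R) :
  (forall i, f ^~ i @ \oo --> 0) -> (fun t => \sum_i `|f t i|) @ \oo --> 0.
Proof.
move=> f0; elim: (index_enum _) => [|i l IH].
  by under eq_fun do rewrite big_nil; exact: cvg_cst.
rewrite (_ : (fun t => _) = fun t => `|f t i| + \sum_(j <- l) `|f t j|); last first.
  by apply/funext => t; rewrite big_cons.
rewrite -[X in _ --> X]addr0; apply: cvgD IH.
by rewrite -[X in _ --> X](normr0 R); apply: cvg_norm; exact: f0.
Qed.

Lemma acdq_pathwise_cvg x y :
  ((fun t => (q t).1 x y) @ \oo --> Qstar x y) /\
  ((fun t => (q t).2 x y) @ \oo --> Qstar x y).
Proof.
(* Sums over the finitely many pairs serve as bounds uniform in the pair. *)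
pose dl t : R := \sum_(i : S * A) `|(q t).1 i.1 i.2 - (q t).2 i.1 i.2|.
pose ze t : R := \sum_(i : S * A) `|oracle_iter t i.1 i.2 - Qstar i.1 i.2|.
have dl0 : dl @ \oo --> 0.
  apply: (@cvg_sum_norm0 (fun t i => (q t).1 i.1 i.2 - (q t).2 i.1 i.2)) => i.
  exact: acdq_diff_cvg0.
have ze0 : ze @ \oo --> 0.
  apply: (@cvg_sum_norm0 (fun t i => oracle_iter t i.1 i.2 - Qstar i.1 i.2)) => i.
  exact: oracle_error_cvg0.
have dlP t x' y' : `|(q t).1 x' y' - (q t).2 x' y'| <= dl t.
  by rewrite /dl (bigD1 (x', y'))//= lerDl sumr_ge0.
have zeP t x' y' : `|oracle_iter t x' y' - Qstar x' y'| <= ze t.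
  by rewrite /ze (bigD1 (x', y'))//= lerDl sumr_ge0.
have eta0 : (fun t => 3 * dl t + ze t) @ \oo --> 0.
  rewrite -[X in _ --> X]addr0; apply: cvgD => //.
  by rewrite -[X in _ --> X](mulr0 3); apply: cvgM => //; exact: cvg_cst.
have D0 : (fun t => (q t).1 x y - oracle_iter t x y) @ \oo --> 0.
  have := @contraction_cvg0 _ (S * A)%type (fun t i => alpha t i.1 i.2 w)
    (fun t i => (q t).1 i.1 i.2 - oracle_iter t i.1 i.2)
    (fun t => 3 * dl t + ze t) gamma gamma01.
  move=> /(_ (fun i => alpha01 i.1 i.2) (fun i => alpha_div i.1 i.2)).
  move=> H; apply: (H _ eta0 (x, y)) => t b Db [x' y'] /=.
  have /andP[a0 a1] := alpha01 x' y' t.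
  rewrite acdq_iterS1.
  set v := maxA (Qstar (s t.+1 w)).
  (* The sampled reward cancels. What remains, [target t - v], costs [3 * dl t] to reach the maximum
     of the first table, then [b + ze t] to reach [v] through the oracle. *)
  have -> : (q t).1 x' y' + alpha t x' y' w * (r t w + gamma * target t - (q t).1 x' y')
    - (oracle_iter t x' y' + alpha t x' y' w * (r t w + gamma * v - oracle_iter t x' y'))
    = (1 - alpha t x' y' w) * ((q t).1 x' y' - oracle_iter t x' y')
      + alpha t x' y' w * (gamma * (target t - v)) by ring.
  rewrite (le_trans (ler_normD _ _))// !normrM (ger0_norm a0).
  rewrite [`|1 - _|]ger0_norm ?subr_ge0// lerD2l ler_wpM2l//.
  have /andP[g0 _] := gamma01; rewrite ger0_norm// ler_wpM2l//.
  have h1 : `|target t - maxA ((q t).1 (s t.+1 w))| <= 3 * dl t.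
    by apply: (clipped_target_dist sel_rule) => b'; exact: dlP.
  have h2 : `|maxA ((q t).1 (s t.+1 w)) - v| <= b + ze t.
    apply: (maxA_dist y) => b'; have := Db (s t.+1 w, b') => /= Dsb.
    rewrite -(subrK (oracle_iter t (s t.+1 w) b') ((q t).1 (s t.+1 w) b')) -addrA.
    by apply: (le_trans (ler_normD _ _)); rewrite lerD.
  rewrite -(subrK (maxA ((q t).1 (s t.+1 w))) (target t)) -addrA.
  apply: (le_trans (ler_normD _ _)); lra.
have qA : (fun t => (q t).1 x y) @ \oo --> Qstar x y.
  rewrite (_ : (fun t => _) = fun t => ((q t).1 x y - oracle_iter t x y)
     + (oracle_iter t x y - Qstar x y) + Qstar x y); last by apply/funext => t; ring.
  rewrite -[X in _ --> X]add0r; apply: cvgD; last exact: cvg_cst.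
  by rewrite -[X in _ --> X]addr0; apply: cvgD => //; exact: oracle_error_cvg0.
split => //.
rewrite (_ : (fun t => _) = fun t => (q t).1 x y - ((q t).1 x y - (q t).2 x y)).
  by rewrite -[X in _ --> X]subr0; apply: cvgB => //; exact: acdq_diff_cvg0.
by apply/funext => t; ring.
Qed.

End pathwise_convergence.

(** * From extended-real series to real partial sums *)

Lemma sum_diverges_eseries (R : realType) (u : nat -> R) : (forall t, 0 <= u t) ->
  (\sum_(0 <= t <oo) (u t)%:E = +oo)%E -> sum_diverges u.
Proof.
move=> u0 uoo B; apply: contrapT => /forallNP h.
have : (\sum_(0 <= t <oo) (u t)%:E <= B%:E)%E.
  apply: lime_le; first by apply: is_cvg_nneseries => t _ _; rewrite lee_fin.
  apply: nearW => T; rewrite sumEFin lee_fin leNgt; apply/negP => /ltW.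
  exact: h.
by rewrite uoo leye_eq.
Qed.

Lemma partial_sums_bounded (R : realType) (u : nat -> R) : (forall t, 0 <= u t) ->
  (\sum_(0 <= t <oo) (u t)%:E < +oo)%E ->
  exists k : R, forall T, \sum_(0 <= t < T) u t <= k.
Proof.
move=> u0 uoo; exists (fine (\sum_(0 <= t <oo) (u t)%:E)%E) => T.
rewrite -lee_fin fineK.
  by rewrite -sumEFin; apply: nneseries_lim_ge => t _ _; rewrite lee_fin.
rewrite ge0_fin_numE//; apply: nneseries_ge0 => t _ _; rewrite lee_fin//.
Qed.

(** * Conditional mean and variance of the Bellman noise *)

Section bellman_noise_moments.
Context {R : realType} d {Omega : measurableType d} (mu : probability Omega R).
Context {S A : finType}.
Variables (gamma : R) (Ptr : S -> A -> S -> R) (Rw V Qstar : S -> A -> R).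
Variables (F : nat -> set (set Omega)).
Variables (s : nat -> Omega -> S) (a : nat -> Omega -> A) (r : nat -> Omega -> R).
Hypothesis Qstar_bellman : bellman_opt gamma Ptr Rw Qstar.
Hypothesis F_sigma : forall t, sigma_algebra setT (F t).
Hypothesis F_measurable : forall t, F t `<=` measurable.
Hypothesis F_mono : forall t, F t `<=` F t.+1.
Hypothesis s_adapted : forall t x, F t [set w | s t w = x].
Hypothesis a_adapted : forall t y, F t [set w | a t w = y].
Hypothesis r_adapted : forall t, wrt_measurable (F t.+1) (r t).
Hypothesis s_law : forall t E x', F t E ->
  mu (E `&` [set w | s t.+1 w = x']) =
  (\int[mu]_(w in E) (Ptr (s t w) (a t w) x')%:E)%E.
Hypothesis r_integrable : forall t, mu.-integrable setT (EFin \o r t).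
Hypothesis r_mean : forall t E, F t E ->
  (\int[mu]_(w in E) (r t w)%:E = \int[mu]_(w in E) (Rw (s t w) (a t w))%:E)%E.
Hypothesis r_variance : forall t E, F t E ->
  (\int[mu]_(w in E) ((r t w - Rw (s t w) (a t w)) ^+ 2)%:E
   = \int[mu]_(w in E) (V (s t w) (a t w))%:E)%E.

Let noise := bellman_noise gamma Qstar s a r.

Lemma F_setI t (E E' : set Omega) : F t E -> F t E' -> F t (E `&` E').
Proof.
have <- := measurable_g_measurableTypeE (F_sigma t).
exact: (@measurableI _ (g_sigma_algebraType (F t))).
Qed.

Lemma state_action_measurable t (f : S -> A -> R) :
  wrt_measurable (F t) (fun w => f (s t w) (a t w)).
Proof.
apply: (@wrt_measurable_finite _ _ _ _ (F_sigma t) (S * A)%type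
  (fun w => (s t w, a t w)) (fun p => f p.1 p.2)) => -[x y].
rewrite (_ : [set w | _] = [set w | s t w = x] `&` [set w | a t w = y]).
  exact: F_setI.
by apply/seteqP; split => w /= [-> ->].
Qed.

Lemma state_action_bound t (f : S -> A -> R) w :
  `|f (s t w) (a t w)| <= \sum_(p : S * A) `|f p.1 p.2|.
Proof. by rewrite (bigD1 (s t w, a t w))//= lerDl sumr_ge0. Qed.

Lemma state_action_integrable t (f : S -> A -> R) :
  mu.-integrable setT (EFin \o (fun w => f (s t w) (a t w))).
Proof.
apply: integrable_bounded (state_action_bound t f).
apply: wrt_measurable_fun; first exact: (@F_measurable t).
exact: state_action_measurable.
Qed.

Let reward_noise t w : R := r t w - Rw (s t w) (a t w).

(** The compensated indicator of a transition to [x'], a martingale difference by [s_law]. *)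
Let jump t x' w : R := \1_[set v | s t.+1 v = x'] w - Ptr (s t w) (a t w) x'.

Let transition_noise t w : R :=
  \sum_x' (gamma * maxA (Qstar x')) * jump t x' w.

(** The Bellman equation rewrites [Qstar] at the current pair, and the maximum at the next state is
    expanded over the indicators of that state. *)
Lemma bellman_noiseE t w : noise t w = reward_noise t w + transition_noise t w.
Proof.
rewrite /noise /bellman_noise Qstar_bellman /reward_noise /transition_noise /jump.
have -> : maxA (Qstar (s t.+1 w)) =
    \sum_x' maxA (Qstar x') * \1_[set v | s t.+1 v = x'] w.
  rewrite (bigD1 (s t.+1 w))//= indicE mem_set//= mulr1 big1 ?addr0// => x' sx'.
  by rewrite indicE memNset ?mulr0//= => /eqP; rewrite eq_sym (negbTE sx').
rewrite [in RHS](eq_bigr (fun x' => gamma * (maxA (Qstar x') * \1_[set v | s t.+1 v = x'] w)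
  - gamma * (Ptr (s t w) (a t w) x' * maxA (Qstar x')))); last by move=> x' _; ring.
by rewrite sumrB -!mulr_sumr; ring.
Qed.

Lemma jump_measurable t x' : wrt_measurable (F t.+1) (jump t x').
Proof.
apply: wrt_measurableB => //; first exact: wrt_measurable_indic.
apply: (wrt_measurable_sub (@F_mono t)).
exact: (state_action_measurable t (fun x y => Ptr x y x')).
Qed.

Lemma jump_bound t x' w :
  `|jump t x' w| <= 1 + \sum_(p : S * A) `|Ptr p.1 p.2 x'|.
Proof.
rewrite (le_trans (ler_normB _ _))// lerD//; last first.
  exact: (state_action_bound t (fun x y => Ptr x y x')).
by rewrite indicE; case: (w \in _); rewrite ?normr1 ?normr0.
Qed.

Lemma jump_integrable t x' : mu.-integrable setT (EFin \o jump t x').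
Proof.
apply: integrable_bounded (jump_bound t x').
exact: wrt_measurable_fun (@F_measurable t.+1) (jump_measurable t x').
Qed.

Lemma jump_centered t x' E : F t E -> \int[mu]_(w in E) jump t x' w = 0.
Proof.
move=> FE; have mE := F_measurable FE.
have ms : measurable [set v | s t.+1 v = x'] by exact: (F_measurable (t := t.+1)).
rewrite /jump RintegralB//.
- rewrite /Rintegral integral_indic// setIC.
  by have <- := s_law x' FE; exact: subrr.
- by apply: integrableS (integrable_indic mu ms).
- apply: integrableS (state_action_integrable t (fun x y => Ptr x y x')) => //.
Qed.

Lemma transition_noise_measurable t : wrt_measurable (F t.+1) (transition_noise t).
Proof.
apply: wrt_measurable_sum => // x'; apply: wrt_measurableM => //.
  exact: wrt_measurable_cst.
exact: jump_measurable.
Qed.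

Let transition_const : R := \sum_x' `|gamma * maxA (Qstar x')| *
  (1 + \sum_(p : S * A) `|Ptr p.1 p.2 x'|).

Lemma transition_noise_bound t w : `|transition_noise t w| <= transition_const.
Proof.
apply: (le_trans (ler_norm_sum _ _ _)); apply: ler_sum => x' _.
by rewrite normrM ler_wpM2l// jump_bound.
Qed.

Lemma transition_noise_centered t E : F t E ->
  \int[mu]_(w in E) transition_noise t w = 0.
Proof.
move=> FE; have mE := F_measurable FE.
rewrite /transition_noise.
suff : mu.-integrable E (EFin \o (fun w => \sum_x' (gamma * maxA (Qstar x')) * jump t x' w)) /\
    \int[mu]_(w in E) (\sum_x' (gamma * maxA (Qstar x')) * jump t x' w) = 0 by case.
elim: (index_enum S) => [|x' l [IHi IH]].
  split.
    rewrite (_ : EFin \o _ = EFin \o cst 0); last by apply/funext => w /=; rewrite big_nil.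
    exact: finite_measure_integrable_cst.
  rewrite (_ : Rintegral _ _ _ = \int[mu]_(w in E) (0 : R)).
    by rewrite Rintegral_cst// mul0r.
  by apply: eq_Rintegral => w _; rewrite big_nil.
have ij : mu.-integrable E (EFin \o jump t x').
  exact: integrableS (jump_integrable t x').
have ij' : mu.-integrable E (EFin \o (fun w => (gamma * maxA (Qstar x')) * jump t x' w)).
  have := integrableZl mE (gamma * maxA (Qstar x')) ij.
  by congr (integrable _ _ _); apply/funext => w /=; rewrite EFinM.
split.
  have := integrableD mE ij' IHi.
  by congr (integrable _ _ _); apply/funext => w /=; rewrite -EFinD big_cons.
rewrite (_ : Rintegral _ _ _ = \int[mu]_(w in E) ((gamma * maxA (Qstar x')) * jump t x' w
  + \sum_(x' <- l) (gamma * maxA (Qstar x')) * jump t x' w)).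
  by rewrite RintegralD// RintegralZl// jump_centered// mulr0 IH addr0.
by apply: eq_Rintegral => w _; rewrite big_cons.
Qed.

Lemma transition_noise_integrable t : mu.-integrable setT (EFin \o transition_noise t).
Proof.
apply: integrable_bounded (transition_noise_bound t).
exact: wrt_measurable_fun (@F_measurable t.+1) (transition_noise_measurable t).
Qed.

Lemma reward_noise_measurable t : wrt_measurable (F t.+1) (reward_noise t).
Proof.
apply: wrt_measurableB => //.
apply: (wrt_measurable_sub (@F_mono t)); exact: state_action_measurable.
Qed.

Lemma reward_noise_integrable t : mu.-integrable setT (EFin \o reward_noise t).
Proof.
have := integrableB measurableT (r_integrable t) (state_action_integrable t Rw).
by congr (integrable _ _ _); apply/funext => w /=; rewrite EFinB.
Qed.

Lemma reward_noise_centered t E : F t E -> \int[mu]_(w in E) reward_noise t w = 0.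
Proof.
move=> FE; have mE := F_measurable FE.
rewrite RintegralB//.
- by rewrite /Rintegral r_mean// subrr.
- exact: integrableS (r_integrable t).
- exact: integrableS (state_action_integrable t Rw).
Qed.

Lemma F_setT t : F t setT.
Proof. by have [F0 FD _] := F_sigma t; rewrite -(setD0 setT); exact: FD. Qed.

(** The variance identity on the full event equates this integral with that of [V] along the
    trajectory, a bounded function. *)
Lemma reward_noise_sq_integrable t :
  mu.-integrable setT (EFin \o (fun w => reward_noise t w ^+ 2)).
Proof.
apply/integrableP; split.
  apply/measurable_EFinP; apply: measurable_funX.
  exact: wrt_measurable_fun (@F_measurable t.+1) (reward_noise_measurable t).
under eq_integral do rewrite /= ger0_norm ?sqr_ge0//.
rewrite /reward_noise r_variance; last exact: F_setT.
have := integrable_fin_num measurableT (state_action_integrable t V).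
by rewrite fin_numElt => /andP[_].
Qed.

Lemma noise_adapted t : wrt_measurable (F t.+1) (noise t).
Proof.
have -> : noise t = fun w => reward_noise t w + transition_noise t w.
  by apply/funext => w; exact: bellman_noiseE.
apply: wrt_measurableD => //; first exact: reward_noise_measurable.
exact: transition_noise_measurable.
Qed.

Lemma noise_integrable t : mu.-integrable setT (EFin \o noise t).
Proof.
have := integrableD measurableT (reward_noise_integrable t) (transition_noise_integrable t).
by congr (integrable _ _ _); apply/funext => w /=; rewrite -EFinD -bellman_noiseE.
Qed.

Lemma noise_centered t E : F t E -> \int[mu]_(w in E) noise t w = 0.
Proof.
move=> FE; have mE := F_measurable FE.
rewrite (_ : Rintegral _ _ _ = \int[mu]_(w in E) (reward_noise t w + transition_noise t w)).
  rewrite RintegralD//.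
  - by rewrite reward_noise_centered// transition_noise_centered// addr0.
  - exact: integrableS (reward_noise_integrable t).
  - exact: integrableS (transition_noise_integrable t).
by apply: eq_Rintegral => w _; exact: bellman_noiseE.
Qed.

(** Obtained from [(x + y) ^+ 2 <= 2 * x ^+ 2 + 2 * y ^+ 2], with the reward variance bounded by the
    sum of [|V|] and the transition noise bounded pointwise. *)
Definition noise_variance_bound : R :=
  2 * (\sum_(p : S * A) `|V p.1 p.2|) + 2 * transition_const ^+ 2.

Lemma noise_variance_bound_ge0 : 0 <= noise_variance_bound.
Proof. by rewrite addr_ge0// mulr_ge0// ?sqr_ge0// sumr_ge0. Qed.

Lemma noise_sq_le t w :
  noise t w ^+ 2 <= 2 * reward_noise t w ^+ 2 + 2 * transition_const ^+ 2.
Proof.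
have : transition_noise t w ^+ 2 <= transition_const ^+ 2.
  rewrite -[leLHS]real_normK ?num_real// lerXn2r ?transition_noise_bound// nnegrE//.
  exact: le_trans (transition_noise_bound t w).
rewrite bellman_noiseE; have := sqr_ge0 (reward_noise t w - transition_noise t w).
by nra.
Qed.

Lemma noise_sq_majorant_integrable t : mu.-integrable setT
  (EFin \o (fun w => 2 * reward_noise t w ^+ 2 + 2 * transition_const ^+ 2)).
Proof.
have i1 := integrableZl measurableT 2 (reward_noise_sq_integrable t).
have i2 := finite_measure_integrable_cst mu (2 * transition_const ^+ 2) measurableT.
have := integrableD measurableT i1 i2.
by congr (integrable _ _ _); apply/funext => w /=; rewrite EFinD EFinM.
Qed.

Lemma noise_sq_integrable t :
  mu.-integrable setT (EFin \o (fun w => noise t w ^+ 2)).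
Proof.
apply: le_integrable (noise_sq_majorant_integrable t) => //.
  apply/measurable_EFinP; apply: measurable_funX.
  exact: wrt_measurable_fun (@F_measurable t.+1) (noise_adapted t).
move=> w _ /=; rewrite lee_fin ger0_norm ?sqr_ge0//.
by rewrite (le_trans (noise_sq_le t w))// ler_norm.
Qed.

Lemma noise_variance t E : F t E ->
  \int[mu]_(w in E) (noise t w ^+ 2) <= noise_variance_bound * fine (mu E).
Proof.
move=> FE; have mE := F_measurable FE.
have iS (f : Omega -> R) : mu.-integrable setT (EFin \o f) -> mu.-integrable E (EFin \o f).
  exact: integrableS.
have i1 := iS _ (reward_noise_sq_integrable t).
have i2 : mu.-integrable E (EFin \o (fun w => 2 * reward_noise t w ^+ 2)).
  have := integrableZl mE 2 i1.
  by congr (integrable _ _ _); apply/funext => w /=; rewrite EFinM.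
have i3 := finite_measure_integrable_cst mu (2 * transition_const ^+ 2) mE.
apply: (@le_trans _ _
  (\int[mu]_(w in E) (2 * reward_noise t w ^+ 2 + 2 * transition_const ^+ 2))).
  apply: le_Rintegral => //.
  - exact/iS/noise_sq_integrable.
  - exact/iS/noise_sq_majorant_integrable.
  - by move=> w _; exact: noise_sq_le.
rewrite RintegralD// RintegralZl// Rintegral_cst// /noise_variance_bound.
rewrite [leRHS]mulrDl lerD2r.
rewrite -mulrA ler_wpM2l//.
have -> : \int[mu]_(w in E) (reward_noise t w ^+ 2) = \int[mu]_(w in E) V (s t w) (a t w).
  by rewrite /Rintegral r_variance.
rewrite -Rintegral_cst//; apply: le_Rintegral => //.
- exact/iS/state_action_integrable.
- exact: finite_measure_integrable_cst.
- move=> w _; apply: le_trans (ler_norm _) _; exact: state_action_bound.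
Qed.

End bellman_noise_moments.

(** * Assembly of the probabilistic and pathwise results *)

Unset Implicit Arguments.

Theorem theorem3 (R : realType) (d : measure_display) (Omega : measurableType d)
  (mu : probability Omega R) (S A : finType) (gamma : R)
  (Ptr : S -> A -> S -> R) (Rw V : S -> A -> R) (Qstar : S -> A -> R)
  (K : nat) (sel : (A -> R) -> (A -> R) -> A) (QA0 QB0 : S -> A -> R)
  (F : nat -> set (set Omega))
  (s : nat -> Omega -> S) (a : nat -> Omega -> A) (r : nat -> Omega -> R)
  (alpha : nat -> S -> A -> Omega -> R) :
  (* MDP *)
  0 <= gamma < 1 ->
  (forall x y x', 0 <= Ptr x y x') ->
  (forall x y, \sum_(x' : S) Ptr x y x' = 1) ->
  bellman_opt gamma Ptr Rw Qstar ->
  (* K in {1, ..., |A|} and the choice rule for a_K^* *)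
  (0 < K <= #|A|)%N ->
  topK_argmax_rule K sel ->
  (* filtration *)
  (forall t, sigma_algebra setT (F t)) ->
  (forall t, F t `<=` measurable) ->
  (forall t, F t `<=` F t.+1) ->
  (* adaptedness *)
  (forall t x, F t [set w | s t w = x]) ->
  (forall t y, F t [set w | a t w = y]) ->
  (forall t x y (B : set R), measurable B -> F t (alpha t x y @^-1` B)) ->
  (forall t (B : set R), measurable B -> F t.+1 (r t @^-1` B)) ->
  (* sampling from the MDP, conditionally on the past F t *)
  (forall t E x', F t E ->
     mu (E `&` [set w | s t.+1 w = x']) =
     (\int[mu]_(w in E) (Ptr (s t w) (a t w) x')%:E)%E) ->
  (forall t, mu.-integrable setT (EFin \o r t)) ->
  (forall t E, F t E ->
     (\int[mu]_(w in E) (r t w)%:E = \int[mu]_(w in E) (Rw (s t w) (a t w))%:E)%E) ->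
  (forall t E, F t E ->
     (\int[mu]_(w in E) ((r t w - Rw (s t w) (a t w)) ^+ 2)%:E
      = \int[mu]_(w in E) (V (s t w) (a t w))%:E)%E) ->
  (* (1) every state-action pair is visited infinitely often *)
  {ae mu, forall w, forall x y (N : nat), exists2 t, (N <= t)%N & s t w = x /\ a t w = y} ->
  (* (3) learning rates *)
  {ae mu, forall w, forall x y,
     [/\ (forall t, 0 <= alpha t x y w <= 1),
         (\sum_(0 <= t <oo) (alpha t x y w)%:E = +oo)%E,
         (\sum_(0 <= t <oo) ((alpha t x y w) ^+ 2)%:E < +oo)%E &
         (forall t, (x, y) <> (s t w, a t w) -> alpha t x y w = 0)]} ->
  {ae mu, forall w, forall x y,
     ((fun t : nat => (acdq_iter gamma sel QA0 QB0 s r alpha t w).1 x y) @ \oo --> Qstar x y) /\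
     ((fun t : nat => (acdq_iter gamma sel QA0 QB0 s r alpha t w).2 x y) @ \oo --> Qstar x y)}.
Proof.
move=> gamma01 _ _ bell _ selK Fs Fm Fmono sF aF alF rF sP rI rE rV _ alpha_ae.
pose noise := bellman_noise gamma Qstar s a r.
have noise_ae : {ae mu, forall w, forall p : S * A,
    cvgn (series (fun t => alpha t p.1 p.2 w * noise t w))}.
  (* Finitely many pairs contribute one null set each. *)
  apply: filter_forall => p.
  apply: (@ae_cvg_weighted_noise _ _ _ mu F noise
    (noise_variance_bound gamma Ptr V Qstar)) => //.
  - exact: noise_variance_bound_ge0.
  - by move=> t; exact: (@noise_adapted _ _ _ _ _ gamma Ptr Rw).
  - by move=> t; exact: (@noise_integrable _ _ _ mu _ _ gamma Ptr Rw Qstar F).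
  - by move=> t; exact: (@noise_sq_integrable _ _ _ mu _ _ gamma Ptr Rw V Qstar F).
  - by move=> t E; exact: (@noise_centered _ _ _ mu _ _ gamma Ptr Rw Qstar F).
  - by move=> t E; exact: (@noise_variance _ _ _ mu _ _ gamma Ptr Rw V Qstar F).
  - by move=> t B mB; exact: alF.
  apply: filterS alpha_ae => w /(_ p.1 p.2)[al01 _ al2 _]; split => //.
  by apply: partial_sums_bounded al2 => t; exact: sqr_ge0.
(* From here on the path [w] is fixed and the argument is deterministic. *)
apply: filterS2 alpha_ae noise_ae => w alw noisew x y.
apply: (@acdq_pathwise_cvg _ _ _ _ gamma K sel Qstar QA0 QB0 s a r alpha w) => //.
- by move=> x' y' t; have [] := alw x' y'.
- move=> x' y'; have [al01 aldiv _ _] := alw x' y'.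
  by apply: sum_diverges_eseries aldiv => t; case/andP: (al01 t).
- by move=> x' y' t; have [_ _ _] := alw x' y'; exact.
- by move=> x' y'; exact: (noisew (x', y')).
Qed.
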